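(* Let $T>0$, let $A:\mathbb{R}\to\mathbb{R}^{n\times n}$ be continuous and $T$-periodic, and consider the linear system $\dot{\mathbf x}=A(t)\mathbf x$, $\mathbf x\in\mathbb{R}^n$. Let $d\in\mathbb{N}$ be the A-index of this system. Then there exist a real matrix $R\in\mathbb{R}^{n\times n}$ and a real matrix function $Q:\mathbb{R}\to\mathbb{R}^{n\times n}$ such that $\Phi(t):=Q(t)e^{tR}$ is a fundamental matrix solution of $\dot{\mathbf x}=A(t)\mathbf x$ and \[ Q(t+T)=Q(t)\,\big[I_{n-d}\oplus(-I_d)\big]\quad\text{for all } t\in\mathbb{R}. \] In particular, the change of variables $\mathbf y=Q^{-1}(t)\mathbf x$ transforms $\dot{\mathbf x}=A(t)\mathbf x$ into the real constant-coefficient system $\dot{\mathbf y}=R\mathbf y$.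
   Context: For a fundamental matrix solution $\Phi(t)$ of $\dot{\mathbf x}=A(t)\mathbf x$, the matrix $\Phi^{-1}(0)\Phi(T)$ is called a monodromy matrix; its Jordan normal form does not depend on the choice of $\Phi$. The A-index (antiperiodicity index) of the system is defined as follows: consider the (complex) Jordan normal form of a monodromy matrix; for each distinct Jordan block associated to a real negative eigenvalue which occurs an odd number of times in this Jordan form, take its dimension (counting each such distinct block only once, regardless of how many times it occurs); the A-index is the sum of these dimensions. $I_m$ denotes the $m\times m$ identity matrix and $\oplus$ denotes the block-diagonal direct sum of square matrices. *)

(* Defs.v *)
From HB Require Import structures.
From mathcomp Require Import all_boot all_order all_algebra.
From mathcomp Require Import all_classical all_reals all_analysis.
From mathcomp Require Import complex.
Set Implicit Arguments. Unset Strict Implicit. Unset Printing Implicit Defensive.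
Import Order.TTheory GRing.Theory Num.Theory.
Import numFieldNormedType.Exports.
Local Open Scope ring_scope.

Section Defs.
Variable R : realType.

Definition expmx (n : nat) (M : 'M[R]_n) : 'M[R]_n :=
  \matrix_(i, j) limn (fun N : nat =>
     ((\sum_(k < N) (k`!%:R)^-1 *: M ^+ k) i j : R^o)).

Definition fundamental_solution (n : nat) (A Phi : R -> 'M[R]_n) : Prop :=
  (forall t : R, Phi t \in unitmx) /\
  (forall (t : R) (i j : 'I_n),
      is_derive t 1 (fun s => Phi s i j) ((A t *m Phi t) i j)).

Definition monodromy (n : nat) (Phi : R -> 'M[R]_n) (T : R) : 'M[R]_n :=
  invmx (Phi 0) *m Phi T.

Definition jblock (l : R[i]) (k : nat) : 'M[R[i]]_k :=
  \matrix_(a, b) (if a == b then l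
                  else if b == a.+1 :> nat then 1 else 0).

Definition jordan_mx (m : nat) (lam : 'I_m -> R[i]) (sz : 'I_m -> nat)
  : 'M[R[i]]_(\sum_(b < m) sz b) :=
  \mxdiag_(b < m) jblock (lam b) (sz b).

Definition is_jordan_form (n : nat) (M : 'M[R]_n) (m : nat)
  (lam : 'I_m -> R[i]) (sz : 'I_m -> nat) : Prop :=
  (forall b, (0 < sz b)%N) /\
  exists (E : (\sum_(b < m) sz b)%N = n) (P : 'M[R[i]]_n),
    P \in unitmx /\
    invmx P *m map_mx (real_complex R) M *m P
      = castmx (E, E) (jordan_mx lam sz).

Definition aindex_of (m : nat) (lam : 'I_m -> R[i]) (sz : 'I_m -> nat) : nat :=
  let blocks := [seq (lam b, sz b) | b <- enum 'I_m] in
  (\sum_(p <- undup blocks |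
        (complex.Im p.1 == 0%R) && (complex.Re p.1 < 0)%R && odd (count_mem p blocks)) p.2)%N.

Definition sign_block (n d : nat) : 'M[R]_n :=
  \matrix_(a, b) (if a == b then (if (a < n - d)%N then 1 else -1) else 0).

End Defs.

(* Main.v *)
Require Import Defs.
From HB Require Import structures.
From mathcomp Require Import all_boot all_order all_algebra.
From mathcomp Require Import all_classical all_reals all_analysis.
From mathcomp Require Import complex.
From mathcomp Require Import zify ring.
Set Implicit Arguments. Unset Strict Implicit. Unset Printing Implicit Defensive.
Import Order.TTheory GRing.Theory Num.Theory.
Import numFieldNormedType.Exports.
Local Open Scope ring_scope.

(** If the monodromy matrix M satisfies S^-1 M S = J e^B with J = I (+) (-I_d)
    and J B = B J, then Q(t) = Phi(t) S e^(-tB/T) works with R = B/T, because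
    Phi(t + T) = Phi(t) M. To find B, note that the Jordan form of the real
    matrix M is closed under conjugation, so up to order it consists of blocks
    with positive eigenvalue, of pairs of conjugate blocks (among them pairs of
    equal blocks with negative eigenvalue), and of one copy of each negative
    block that occurs an odd number of times. Single positive blocks and
    conjugate pairs are Jordan forms of exponentials of explicit real matrices,
    and the remaining negative blocks of opposites of such. This yields a real
    matrix J e^B that is similar to M over the complex numbers, hence over the
    reals. *)

(** * Similarity, Jordan matrices and uniqueness of the Jordan form *)

Section Similarity.
Variable F : fieldType.

(* The sizes n1 and n2 are kept distinct: they are forced to be equal, but in
   general not convertible, and this avoids casts. *)
Definition simm n1 n2 (A : 'M[F]_n1) (B : 'M[F]_n2) : Prop :=
  exists (P : 'M[F]_(n1, n2)) (Q : 'M[F]_(n2, n1)),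
    [/\ P *m Q = 1%:M, Q *m P = 1%:M & A *m P = P *m B].

Lemma simm_refl n (A : 'M[F]_n) : simm A A.
Proof. by exists 1%:M, 1%:M; rewrite !mulmx1 mul1mx. Qed.

Lemma simm_sym n1 n2 (A : 'M[F]_n1) (B : 'M[F]_n2) : simm A B -> simm B A.
Proof.
move=> [P [Q [PQ QP AP]]]; exists Q, P; split=> //.
by rewrite -[B *m Q]mul1mx -QP -!mulmxA (mulmxA P) -AP -!mulmxA PQ mulmx1.
Qed.

Lemma simm_trans n1 n2 n3 (B : 'M[F]_n2) (A : 'M[F]_n1) (C : 'M[F]_n3) :
  simm A B -> simm B C -> simm A C.
Proof.
move=> [P [Q [PQ QP AP]]] [P' [Q' [PQ' QP' AP']]].
exists (P *m P'), (Q' *m Q); split.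
- by rewrite -mulmxA (mulmxA P') PQ' mul1mx.
- by rewrite -mulmxA (mulmxA Q) QP mul1mx.
- by rewrite mulmxA AP -!mulmxA AP'.
Qed.

Lemma simm_dim n1 n2 (A : 'M[F]_n1) (B : 'M[F]_n2) : simm A B -> n1 = n2.
Proof.
move=> [P [Q [PQ QP _]]]; apply/eqP; rewrite eqn_leq.
by rewrite (mulmx1_min PQ) (mulmx1_min QP).
Qed.

Lemma simm_cast n1 n2 (E : n1 = n2) (A : 'M[F]_n1) : simm (castmx (E, E) A) A.
Proof. by case: _ / E; rewrite castmx_id; exact: simm_refl. Qed.

Lemma simm_rank n1 n2 (A : 'M[F]_n1) (B : 'M[F]_n2) :
  simm A B -> \rank A = \rank B.
Proof.
move=> h; have e := simm_dim h; case: n2 / e B h => B [P [Q [PQ QP AP]]].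
have [uP uQ] := mulmx1_unit PQ.
rewrite -(mxrankMfree A (_ : row_free P)) ?row_free_unit // AP.
by rewrite -mxrank_tr trmx_mul mxrankMfree ?mxrank_tr // row_free_unit unitmx_tr.
Qed.

Lemma simm_shift n1 n2 (A : 'M[F]_n1) (B : 'M[F]_n2) c :
  simm A B -> simm (A - c%:M) (B - c%:M).
Proof.
move=> [P [Q [PQ QP AP]]]; exists P, Q; split=> //.
by rewrite mulmxBl mulmxBr AP mul_scalar_mx mul_mx_scalar.
Qed.

Lemma simm_exp n1 n2 (A : 'M[F]_n1) (B : 'M[F]_n2) j :
  simm A B -> simm (A ^+ j) (B ^+ j).
Proof.
move=> [P [Q [PQ QP AP]]]; exists P, Q; split=> //.
elim: j => [|j IHj]; first by rewrite !expr0 mul1mx mulmx1.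
by rewrite !exprS -!mulmxE -mulmxA IHj mulmxA AP mulmxA.
Qed.

Definition dsum n1 n2 (A : 'M[F]_n1) (B : 'M[F]_n2) : 'M[F]_(n1 + n2) :=
  block_mx A 0 0 B.

Lemma dsumE n1 n2 (A : 'M[F]_n1) (B : 'M[F]_n2) : dsum A B = block_mx A 0 0 B.
Proof. by []. Qed.

Lemma simm_dsum n1 n2 n1' n2' (A : 'M[F]_n1) (A' : 'M[F]_n1')
    (B : 'M[F]_n2) (B' : 'M[F]_n2') :
  simm A A' -> simm B B' -> simm (dsum A B) (dsum A' B').
Proof.
move=> [P [Q [PQ QP AP]]] [P' [Q' [PQ' QP' AP']]].
exists (block_mx P 0 0 P'), (block_mx Q 0 0 Q').
by split; rewrite !mulmx_block !mulmx0 !mul0mx !addr0 !add0r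
  ?PQ ?PQ' ?QP ?QP' ?AP ?AP' // -scalar_mx_block.
Qed.

Lemma simm_dsumC n1 n2 (A : 'M[F]_n1) (B : 'M[F]_n2) :
  simm (dsum A B) (dsum B A).
Proof.
exists (block_mx 0 1%:M 1%:M 0), (block_mx 0 1%:M 1%:M 0).
by split; rewrite !mulmx_block !mulmx0 !mul0mx !addr0 !add0r ?mul1mx ?mulmx1 //
   -scalar_mx_block.
Qed.

Lemma simm_dsumA n1 n2 n3 (A : 'M[F]_n1) (B : 'M[F]_n2) (C : 'M[F]_n3) :
  simm (dsum A (dsum B C)) (dsum (dsum A B) C).
Proof.
rewrite !dsumE.
have := @block_mxA F n1 n2 n3 n1 n2 n3 A 0 0 0 B 0 0 0 C; rewrite /= !row_mx0 !col_mx0.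
move=> ->; exact: simm_cast.
Qed.

Lemma dsum_exp n1 n2 (A : 'M[F]_n1) (B : 'M[F]_n2) j :
  dsum A B ^+ j = dsum (A ^+ j) (B ^+ j).
Proof.
elim: j => [|j IHj]; first by rewrite !expr0 [LHS]scalar_mx_block.
rewrite !exprS IHj -!mulmxE mulmx_block.
by rewrite !mulmx0 !mul0mx !addr0 !add0r.
Qed.

Lemma dsum_shift n1 n2 (A : 'M[F]_n1) (B : 'M[F]_n2) c :
  dsum A B - c%:M = dsum (A - c%:M) (B - c%:M).
Proof.
by rewrite /dsum (scalar_mx_block n1 n2) opp_block_mx add_block_mx !oppr0 !addr0.
Qed.

(** The same block as [jblock], over an arbitrary field, so that it serves over the reals as well as
    over the complex numbers. *)
Definition jb (l : F) k : 'M[F]_k :=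
  \matrix_(a, b) (if a == b then l else if b == a.+1 :> nat then 1 else 0).

Fixpoint jdim (L : seq (F * nat)) : nat :=
  if L is p :: L' then (p.2 + jdim L')%N else 0%N.

(** Jordan matrices are indexed by lists of pairs (eigenvalue, size), so that blocks can be
    permuted, split and counted with the tools for lists. *)
Fixpoint jmx (L : seq (F * nat)) : 'M[F]_(jdim L) :=
  match L return 'M[F]_(jdim L) with
  | [::] => 0
  | p :: L' => dsum (jb p.1 p.2) (jmx L')
  end.

Lemma jdimE L : jdim L = (\sum_(p <- L) p.2)%N.
Proof. by elim: L => [|p L IH] /=; rewrite ?big_nil // big_cons IH. Qed.

Lemma simm_dim0 (A B : 'M[F]_0) : simm A B.
Proof. by rewrite (flatmx0 A) (flatmx0 B); exact: simm_refl. Qed.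

Lemma simm_dsum0 n (A : 'M[F]_n) (Z : 'M[F]_0) : simm (dsum Z A) A.
Proof.
pose P : 'M[F]_(0 + n, n) := col_mx 0 1%:M.
pose Q : 'M[F]_(n, 0 + n) := row_mx 0 1%:M.
have QP : Q *m P = 1%:M by rewrite mul_row_col mul0mx add0r mulmx1.
exists P, Q.
split=> //; first exact: (@mulmx1C F n _ _ QP).
by rewrite mul_block_col mul_col_mx !mulmx0 !mul0mx !add0r mulmx1 mul1mx.
Qed.

Lemma simm_jmx_cat L1 L2 : simm (jmx (L1 ++ L2)) (dsum (jmx L1) (jmx L2)).
Proof.
elim: L1 => [|p L1 IH] /=; first exact/simm_sym/simm_dsum0.
apply: simm_trans (simm_dsumA _ _ _).
exact: simm_dsum (simm_refl _) IH.
Qed.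

Lemma simm_jmx_perm L1 L2 : perm_eq L1 L2 -> simm (jmx L1) (jmx L2).
Proof.
elim: L1 L2 => [|p L1 IH] L2.
  by move/perm_size/esym/size0nil=> ->; exact: simm_refl.
move=> h; have pL2 : p \in L2 by rewrite -(perm_mem h) mem_head.
case/splitPr: pL2 h => a b; rewrite -(cat1s p b) perm_sym perm_catCA /=.
rewrite perm_cons perm_sym => /IH /simm_trans h.
apply: simm_trans (simm_dsum (simm_refl (jb p.1 p.2)) (h _ _ (simm_jmx_cat _ _))) _.
apply: simm_trans (simm_dsumA _ _ _) _.
apply: simm_sym; apply: simm_trans (simm_jmx_cat _ _) _.
apply: simm_trans (simm_dsumA _ _ _) _.
exact: simm_dsum (simm_dsumC _ _) (simm_refl _).
Qed.

Lemma jb_shift l k c : jb l k - c%:M = jb (l - c) k.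
Proof.
by apply/matrixP=> a b; rewrite !mxE; case: eqVneq => // _; rewrite subr0.
Qed.

Lemma unitmx_utri k (A : 'M[F]_k) :
  (forall i j : 'I_k, (j < i)%N -> A i j = 0) -> (forall i, A i i != 0) ->
  A \in unitmx.
Proof.
move=> Autri Adiag; rewrite -unitmx_tr unitmxE unitfE det_trig.
  by apply/prodf_neq0 => i _; rewrite mxE.
by apply/is_trig_mxP => i j ij; rewrite mxE Autri.
Qed.

Lemma jb_unit l k : l != 0 -> jb l k \in unitmx.
Proof.
move=> l0; apply: unitmx_utri => [i j ij|i]; rewrite mxE ?eqxx //.
by rewrite -val_eqE gtn_eqF // ltn_eqF // ltnW.
Qed.

Lemma jb0_exp k j (a b : 'I_k) : (jb 0 k ^+ j) a b = (b == a + j :> nat)%N%:R.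
Proof.
elim: j a b => [|j IHj] a b.
  by rewrite expr0 addn0 mxE eq_sym.
rewrite exprS -mulmxE mxE addnS.
have [lt_a|ge_a] := ltnP a.+1 k.
  rewrite (bigD1 (Ordinal lt_a)) //= IHj big1 => [|c nc].
    by rewrite !mxE -val_eqE /= ltn_eqF // eqxx mul1r addr0 addSn.
  rewrite !mxE; case: eqP => _; rewrite ?mul0r //.
  by rewrite (_ : (_ == _) = false) ?mul0r //; apply: negbTE.
rewrite big1 => [|c _]; first by case: eqP => //= e; have := ltn_ord b; lia.
rewrite !mxE; case: eqP => _; rewrite ?mul0r //.
by case: eqP => //= e; rewrite ?mul0r //; have := ltn_ord c; lia.
Qed.

(** The product of the power with its transpose is a partial identity of rank [k - j], which bounds
    the rank from below. The same partial identity fixes the power from the left, which bounds the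
    rank from above. *)
Lemma rank_jb0_exp k j : \rank (jb 0 k ^+ j) = (k - j)%N.
Proof.
have Npid : jb 0 k ^+ j *m (jb 0 k ^+ j)^T = pid_mx (k - j).
  apply/matrixP => a c; rewrite !mxE.
  have [lt_a|ge_a] := ltnP a (k - j).
    have aj : (a + j < k)%N by lia.
    rewrite (bigD1 (Ordinal aj)) //= big1 => [|b nb].
      by rewrite mxE !jb0_exp /= eqxx mul1r addr0 eqn_add2r andbT.
    by rewrite mxE !jb0_exp (_ : _ == _ = false) ?mul0r //; apply: negbTE.
  rewrite big1 ?andbF // => b _; rewrite mxE !jb0_exp.
  by case: eqP => e; rewrite ?mul0r //; have := ltn_ord b; lia.
have pidN : pid_mx (k - j) *m jb 0 k ^+ j = jb 0 k ^+ j.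
  apply/matrixP => a c; rewrite !mxE (bigD1 a) //= big1 => [|b nb]; last first.
    by rewrite mxE val_eqE eq_sym (negPf nb) mul0r.
  rewrite !mxE eqxx jb0_exp addr0 /=; case: ltnP => h; rewrite ?mul1r ?mul0r //.
  by case: eqP => // e; have := ltn_ord c; lia.
apply/eqP; rewrite eqn_leq; apply/andP; split.
  by rewrite -pidN (leq_trans (mxrankM_maxl _ _)) // rank_pid_mx // leq_subr.
rewrite -{1}(rank_pid_mx F (leq_subr j k) (leq_subr j k)) -Npid.
exact: mxrankM_maxl.
Qed.

Lemma rank_jb_shift_exp l c k j :
  \rank ((jb l k - c%:M) ^+ j) = (if l == c then k - j else k)%N.
Proof.
rewrite jb_shift; case: eqVneq => [->|lc]; first by rewrite subrr rank_jb0_exp.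
have u : jb (l - c) k \in unitmx by rewrite jb_unit // subr_eq0.
apply: mxrank_unit; elim: j => [|j IHj]; first by rewrite expr0 unitmx1.
by rewrite exprS -mulmxE unitmx_mul u.
Qed.

Lemma rank_jmx_shift_exp L c j :
  \rank ((jmx L - c%:M) ^+ j) =
  (\sum_(p <- L) if p.1 == c then p.2 - j else p.2)%N.
Proof.
elim: L => [|p L IH] /=; first by rewrite big_nil; apply/eqP; rewrite -leqn0 rank_leq_row.
by rewrite dsum_shift dsum_exp rank_diag_block_mx IH rank_jb_shift_exp big_cons.
Qed.

(* The number of blocks (c, k) is the second difference of the ranks of
   (J - c)^j at j = k. *)
Lemma count_jmx L c k : (0 < k)%N ->
  (\rank ((jmx L - c%:M) ^+ k.-1) + \rank ((jmx L - c%:M) ^+ k.+1) =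
   (\rank ((jmx L - c%:M) ^+ k)).*2 + count_mem (c, k) L)%N.
Proof.
move=> k0; rewrite !rank_jmx_shift_exp -mul2n big_distrr -sum1_count /=.
rewrite (big_mkcond (fun j => j == (c, k))) -!big_split /=.
apply: eq_bigr => -[l k1] _ /=; rewrite xpair_eqE.
by case: eqVneq => _ /=; [case: eqVneq => [->|] | ]; lia.
Qed.

(** Similar matrices have equal ranks of all powers of all shifts, and by [count_jmx] these ranks
    determine every multiplicity. Empty blocks leave no trace in the ranks, so they are excluded. *)
Lemma simm_jmx_inj L1 L2 :
  all (fun p => 0 < p.2)%N L1 -> all (fun p => 0 < p.2)%N L2 ->
  simm (jmx L1) (jmx L2) -> perm_eq L1 L2.
Proof.
move=> pos1 pos2 h; apply/allP => -[c k] _ /=; apply/eqP.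
have [k0|k0] := posnP k.
  have no L : all (fun p : F * nat => 0 < p.2)%N L -> count_mem (c, k) L = 0%N.
    move=> /allP posL; apply/count_memPn/negP => /posL.
    by rewrite /= k0.
  by rewrite !no.
have r j := simm_rank (simm_exp j (simm_shift c h)).
have e1 := count_jmx L1 c k0; have e2 := count_jmx L2 c k0.
by apply/eqP; rewrite -(eqn_add2l (\rank ((jmx L1 - c%:M) ^+ k)).*2) -e1 !r e2.
Qed.

End Similarity.

(** * Upper triangular matrices that are similar to a single Jordan block *)

Section UpperTriangular.
Variable F : fieldType.

Lemma utri_exp k (Z : 'M[F]_k) i (a b : 'I_k) :
  (forall a b : 'I_k, (b <= a)%N -> Z a b = 0) ->
  (b < a + i)%N -> (Z ^+ i) a b = 0.
Proof.
move=> Z0; elim: i a b => [|i IHi] a b ltb.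
  by move: ltb; rewrite addn0 expr0 mxE -val_eqE => h; rewrite gtn_eqF.
rewrite exprSr -mulmxE mxE big1 // => c _.
have [lt_c|ge_c] := ltnP c (a + i); first by rewrite IHi // mul0r.
by rewrite Z0 ?mulr0 //; lia.
Qed.

(** Brings the exponential of a Jordan block, which is upper triangular but in general not a Jordan
    block, back to Jordan form. Nonzero superdiagonal entries give [Z - l%:M] the maximal nilpotency
    index [k], hence a single block. *)
Lemma simm_jb_utri l k (Z : 'M[F]_k) :
  (forall a b : 'I_k, (b < a)%N -> Z a b = 0) ->
  (forall a, Z a a = l) ->
  (forall a b : 'I_k, b = a.+1 :> nat -> Z a b != 0) ->
  simm Z (jb l k).
Proof.
case: k Z => [|k] Z Zlow Zdiag Zup; first exact: simm_dim0.
pose N := Z - l%:M.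
have Nlow (a b : 'I_k.+1) : (b <= a)%N -> N a b = 0.
  rewrite !mxE leq_eqVlt => /orP[/eqP/val_inj ->|ba].
    by rewrite eqxx Zdiag subrr.
  by rewrite Zlow // -val_eqE gtn_eqF // subr0.
have Nup (a b : 'I_k.+1) : b = a.+1 :> nat -> N a b != 0.
  by move=> e; rewrite !mxE -val_eqE /= e ltn_eqF // subr0 Zup.
(* The rows e_0 N^i form a Jordan chain. *)
pose W := \matrix_(i < k.+1) row 0 (N ^+ i).
have WE (i j : 'I_k.+1) : W i j = (N ^+ i) 0 j by rewrite !mxE.
(* This entry is the product of the first [i] superdiagonal entries of [N]; the matrix [W] is upper
   triangular with these on its diagonal. *)
have Wdiag (i : nat) (lti : (i < k.+1)%N) : (N ^+ i) 0 (Ordinal lti) != 0.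
  elim: i lti => [|i IHi] lti; first by rewrite expr0 mxE oner_eq0.
  rewrite exprSr -mulmxE mxE (bigD1 (Ordinal (ltnW lti))) //= big1 => [|c nc].
    by rewrite addr0 mulf_neq0 ?Nup.
  have [lt_c|ge_c] := ltnP c i; first by rewrite utri_exp ?mul0r.
  rewrite Nlow ?mulr0 //= ltn_neqAle ge_c andbT eq_sym.
  by move: nc; rewrite -val_eqE.
have Wu : W \in unitmx.
  apply: unitmx_utri => [i j ij|i]; rewrite WE; first exact: utri_exp.
  by case: i => i lti; exact: Wdiag.
(* Row [i] of both sides is row 0 of [N ^+ i.+1]. For the last [i] this row vanishes, since
   [N ^+ k.+1] is zero. *)
have NW : jb 0 k.+1 *m W = W *m N.
  apply/matrixP => i j; transitivity ((N ^+ i.+1) 0 j); last first.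
    rewrite exprSr -mulmxE !mxE; apply: eq_bigr => c _.
    by rewrite WE.
  rewrite mxE; have [lti|gei] := ltnP i.+1 k.+1.
    rewrite (bigD1 (Ordinal lti)) //= big1 => [|c nc].
      by rewrite WE mxE -val_eqE /= ltn_eqF // eqxx mul1r addr0.
    rewrite mxE; case: eqP => _; rewrite ?mul0r //.
    by rewrite (_ : (_ == _) = false) ?mul0r //; apply: negbTE.
  rewrite big1 => [|c _].
    by rewrite utri_exp // add0n (leq_trans (ltn_ord j)).
  rewrite !mxE; case: eqP => _; rewrite ?mul0r //.
  by case: eqP => //= e; rewrite ?mul0r //; have := ltn_ord c; lia.
have : simm (jb 0 k.+1) N by exists W, (invmx W); rewrite mulmxV // mulVmx.
move/(simm_shift (- l)); rewrite jb_shift opprK add0r /N.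
by rewrite !raddfN /= opprK subrK => /simm_sym; apply: simm_trans; exact: simm_refl.
Qed.

End UpperTriangular.

(** * Similarity and Jordan matrices under field morphisms *)

Section MapSimilarity.
Variables (F K : fieldType) (f : {rmorphism F -> K}).

Lemma simm_map n1 n2 (A : 'M[F]_n1) (B : 'M[F]_n2) :
  simm A B -> simm (map_mx f A) (map_mx f B).
Proof.
move=> [P [Q [PQ QP AP]]]; exists (map_mx f P), (map_mx f Q).
by split; rewrite -!map_mxM /= ?PQ ?QP ?AP // map_mx1.
Qed.

Lemma map_dsum n1 n2 (A : 'M[F]_n1) (B : 'M[F]_n2) :
  map_mx f (dsum A B) = dsum (map_mx f A) (map_mx f B).
Proof. by rewrite !dsumE map_block_mx !map_mx0. Qed.

Lemma map_jb l k : map_mx f (jb l k) = jb (f l) k.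
Proof.
by apply/matrixP => a b; rewrite !mxE; do 2 case: ifP => _ //; rewrite ?rmorph0 ?rmorph1.
Qed.

Lemma simm_map_jmx L :
  simm (map_mx f (jmx L)) (jmx [seq (f p.1, p.2) | p <- L]).
Proof.
elim: L => [|p L IH] /=; first exact: simm_dim0.
by rewrite map_dsum map_jb; exact: simm_dsum (simm_refl _) IH.
Qed.

End MapSimilarity.

(** * Real matrices that are similar over the complex numbers *)

Section RealSimilarity.
Variable R : rcfType.
Local Notation rc := (real_complex R).

(** In characteristic zero the first [size p] natural numbers are distinct, and they are more points
    than [p] has roots. *)
Lemma exists_nonroot (p : {poly R}) : p != 0 -> exists x, ~~ root p x.
Proof.
move=> p0; pose s := [seq i%:R : R | i <- iota 0 (size p)].
have us : uniq s by rewrite map_inj_uniq ?iota_uniq //; exact: mulrIn (oner_neq0 R).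
have : ~~ all (root p) s.
  apply/negP => rs; have := max_poly_roots p0 rs us.
  by rewrite size_map size_iota ltnn.
by move/allPn => [x _ nx]; exists x.
Qed.

Lemma Re_mulmx m n p (M : 'M[R]_(m, n)) (P : 'M[R[i]]_(n, p)) :
  map_mx (@complex.Re R) (map_mx rc M *m P) = M *m map_mx (@complex.Re R) P.
Proof.
apply/matrixP => i j; rewrite !mxE raddf_sum /=; apply: eq_bigr => k _.
by rewrite !mxE; case: (P k j) => a b /=; rewrite mul0r subr0.
Qed.

Lemma Im_mulmx m n p (M : 'M[R]_(m, n)) (P : 'M[R[i]]_(n, p)) :
  map_mx (@complex.Im R) (map_mx rc M *m P) = M *m map_mx (@complex.Im R) P.
Proof.
apply/matrixP => i j; rewrite !mxE raddf_sum /=; apply: eq_bigr => k _.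
by rewrite !mxE; case: (P k j) => a b /=; rewrite mul0r addr0.
Qed.

Lemma Re_mulmxr m n p (P : 'M[R[i]]_(m, n)) (M : 'M[R]_(n, p)) :
  map_mx (@complex.Re R) (P *m map_mx rc M) = map_mx (@complex.Re R) P *m M.
Proof.
apply/matrixP => i j; rewrite !mxE raddf_sum /=; apply: eq_bigr => k _.
by rewrite !mxE; case: (P i k) => a b /=; rewrite mulr0 subr0.
Qed.

Lemma Im_mulmxr m n p (P : 'M[R[i]]_(m, n)) (M : 'M[R]_(n, p)) :
  map_mx (@complex.Im R) (P *m map_mx rc M) = map_mx (@complex.Im R) P *m M.
Proof.
apply/matrixP => i j; rewrite !mxE raddf_sum /=; apply: eq_bigr => k _.
by rewrite !mxE; case: (P i k) => a b /=; rewrite mulr0 add0r.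
Qed.

(** Since [M] and [N] are real, the real and imaginary parts of [P] both intertwine them, and so do
    all real combinations of the two. It remains to find an invertible combination. *)
Lemma simm_complex_real n1 n2 (M : 'M[R]_n1) (N : 'M[R]_n2) :
  simm (map_mx rc M) (map_mx rc N) -> simm M N.
Proof.
move=> h; have e := simm_dim h; case: n2 / e N h => N [P [Q [PQ _ MP]]].
have uP : \det P != 0 by rewrite -unitfE -unitmxE; case: (mulmx1_unit PQ).
pose P1 := map_mx (@complex.Re R) P; pose P2 := map_mx (@complex.Im R) P.
have MP1 : M *m P1 = P1 *m N by rewrite -Re_mulmx MP Re_mulmxr.
have MP2 : M *m P2 = P2 *m N by rewrite -Im_mulmx MP Im_mulmxr.
(* det (P1 + x P2) is a polynomial in x that does not vanish at x = i. *)
pose q : {poly R} := \det (map_mx polyC P1 + 'X *: map_mx polyC P2).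
have qE x : q.[x] = \det (P1 + x *: P2).
  rewrite -[LHS]/(horner_eval x q) -det_map_mx; congr (\det _).
  by apply/matrixP => i j; rewrite !mxE /= /horner_eval !hornerE /= ?mxE.
have q0 : q != 0.
  apply: contraNneq uP => q0; have : (map_poly rc q).['i%C] = 0.
    by rewrite q0 rmorph0 horner0.
  rewrite -[X in X = 0]/(horner_eval 'i%C _) -!det_map_mx => <-; apply/eqP.
  congr (\det _); apply/matrixP => i j.
  rewrite !mxE /= /horner_eval rmorphD rmorphM /= map_polyX !map_polyC /= !hornerE.
  by case: (P i j) => a b; simpc.
have [x] := exists_nonroot q0; rewrite rootE qE => ux.
have {}ux : P1 + x *: P2 \in unitmx by rewrite unitmxE unitfE.
exists (P1 + x *: P2), (invmx (P1 + x *: P2)).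
by rewrite mulmxV // mulVmx // mulmxDl mulmxDr MP1 -scalemxAl -scalemxAr MP2.
Qed.

End RealSimilarity.

(** * Splitting a conjugation-invariant list of Jordan blocks *)

Section JordanSplitting.

(** The list [D] receives one copy of each element of odd multiplicity, and [E] half of the
    remaining copies. A new element either enters [D] or, if it is already there, leaves [D] and
    passes to [E] as a pair. *)
Lemma perm_uniq_double (T : eqType) (s : seq T) :
  exists D E, uniq D /\ perm_eq s (D ++ E ++ E).
Proof.
elim: s => [|x s [D [E [uD pD]]]]; first by exists [::], [::].
have [xD|xD] := boolP (x \in D).
  exists (rem x D), (x :: E); split; first exact: rem_uniq.
  have h := perm_to_rem xD.
  apply/permP => a; move/permP/(_ a): pD; move/permP/(_ a): h.
  by rewrite /= !count_cat /= count_cat /= => -> ->; lia.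
exists (x :: D), E; split; first by rewrite /= xD.
by rewrite cat_cons perm_cons.
Qed.

Variable R : rcfType.
Local Notation rc := (real_complex R).
Implicit Types (p : R[i] * nat) (L : seq (R[i] * nat)).

Definition conjblock p := (conjc p.1, p.2).
Definition posblock p := (complex.Im p.1 == 0) && (0 < complex.Re p.1).
Definition negblock p := (complex.Im p.1 == 0) && (complex.Re p.1 < 0).

Lemma conjblock_neg p : negblock p -> conjblock p = p.
Proof. by case: p => [[a b] k] /andP[/eqP /= -> _]; rewrite /conjblock /= oppr0. Qed.

(** Invariance under conjugation makes the blocks below the real axis the conjugates of those above
    it, with the same multiplicities. *)
Lemma perm_conj_upper L : perm_eq L [seq conjblock p | p <- L] ->
  perm_eq L ([seq p <- L | complex.Im p.1 == 0]
    ++ [seq p <- L | 0 < complex.Im p.1]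
    ++ [seq conjblock p | p <- L & 0 < complex.Im p.1]).
Proof.
move=> Lconj; rewrite perm_sym.
have <- : [seq p <- [seq conjblock p | p <- L] | complex.Im p.1 < 0] =
          [seq conjblock p | p <- L & 0 < complex.Im p.1].
  rewrite filter_map; congr map; apply: eq_filter => -[[a b] k] /=.
  by rewrite oppr_lt0.
apply/permP => a; rewrite !count_cat.
rewrite -(permP (perm_filter _ Lconj)) !count_filter.
elim: {Lconj} L => //= p L IH; rewrite -{}IH.
by case: (ltgtP (complex.Im p.1) 0); case: (a p); lia.
Qed.

(** The list [U] holds one block of each conjugate pair: those above the real axis, and half of the
    negative blocks that can be paired off, which are their own conjugates. What is left in [D] are
    the blocks counted by the A-index. *)
Lemma jordan_split L : all (fun p => p.1 != 0) L ->
  perm_eq L [seq conjblock p | p <- L] ->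
  exists G U D, [/\ perm_eq L ((G ++ U ++ [seq conjblock p | p <- U]) ++ D),
    all posblock G, all (fun p => p.1 != 0) U & all negblock D] /\
    uniq D /\ forall p, (p \in D) = negblock p && odd (count_mem p L).
Proof.
move=> L0 Lconj; have [D [E [uD pD]]] := perm_uniq_double [seq p <- L | negblock p].
have negDE p : p \in D ++ E ++ E -> negblock p.
  by rewrite -(perm_mem pD) mem_filter => /andP[].
have negD : all negblock D by apply/allP => p Dp; apply: negDE; rewrite mem_cat Dp.
have negE : all negblock E.
  by apply/allP => p Ep; apply: negDE; rewrite !mem_cat Ep !orbT.
have conjE : [seq conjblock p | p <- E] = E.
  by apply: map_id_in => p /(allP negE)/conjblock_neg.
exists [seq p <- L | posblock p], ([seq p <- L | 0 < complex.Im p.1] ++ E), D.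
split; [split|split] => //.
- apply: perm_trans (perm_conj_upper Lconj) _.
  rewrite map_cat conjE; apply/permP => a.
  (* The eigenvalue 0 is excluded, so a real eigenvalue is either positive or negative. *)
  have : count a [seq p <- L | complex.Im p.1 == 0] =
    (count a [seq p <- L | posblock p] + count a [seq p <- L | negblock p])%N.
    rewrite !count_filter; elim: {pD Lconj} L L0 => //= -[[x y] k] L IH.
    move=> /andP[/= n0 /IH ->]; rewrite /posblock /negblock /=.
    case: (eqVneq y 0) => [y0|]; last by rewrite !andbF /=; lia.
    have : x != 0 by move: n0; rewrite eq_complex /= y0 eqxx andbT.
    by case: ltgtP => //=; case: (a _) => /=; lia.
  rewrite !count_cat => ->; rewrite (permP pD) !count_cat.
  move: (count a D) (count a E) (count a [seq p <- L | posblock p]).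
  by move: (count a (map _ _)) (count a (seq.filter _ _)) => *; lia.
- exact: filter_all.
- rewrite all_cat; apply/andP; split; apply/allP => p.
    by rewrite mem_filter => /andP[_ /(allP L0)].
  move/(allP negE)/andP => [_ Re0]; apply: contraTneq Re0 => ->.
  by rewrite /= ltxx.
- move=> p; have [np /=|np /=] := boolP (negblock p); last first.
    by apply: contraNF np => Dp; apply: negDE; rewrite mem_cat Dp.
  have <- : count_mem p [seq p <- L | negblock p] = count_mem p L.
    rewrite count_filter; apply: eq_count => x /=.
    by case: eqVneq => // ->.
  rewrite (permP pD) !count_cat addnn oddD odd_double addbF count_uniq_mem //.
  by rewrite oddb.
Qed.

Lemma simm_rotation k (c s : R) (P : 'M[R]_k) :
  simm (map_mx rc (block_mx (c *: P) (- (s *: P)) (s *: P) (c *: P)))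
       (dsum ((c +i* s)%C *: map_mx rc P) ((c -i* s)%C *: map_mx rc P)).
Proof.
(* The block columns of [X] come from the eigenvectors (1, -i) and (1, i) of the matrix with rows
   (c, -s) and (s, c), whose eigenvalues are c + is and c - is. *)
pose X : 'M[R[i]]_(k + k) := block_mx 1%:M 1%:M (- 'i%C)%:M 'i%C%:M.
pose Y : 'M[R[i]]_(k + k) := 2^-1 *: block_mx 1%:M 'i%C%:M 1%:M (- 'i%C)%:M.
have i2 : 'i%C * 'i%C = -1 :> R[i] by rewrite -expr2 sqr_i.
have YX : Y *m X = 1%:M.
  rewrite -scalemxAl mulmx_block !mul1mx -!scalar_mxM.
  rewrite !mulrN !mulNr i2 !opprK -!(raddfD (@scalar_mx R[i] k)) /=.
  rewrite subrr raddf0 -(scalar_mx_block k k).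
  by rewrite scale_scalar_mx mulVf // pnatr_eq0.
exists X, Y; split; [exact: mulmx1C|exact: YX|].
rewrite dsumE map_block_mx !mulmx_block !mulmx1 !mulmx0 !add0r !addr0 !mul1mx.
rewrite !mul_mx_scalar !mul_scalar_mx !map_mxN !map_mxZ /= !scalerA.
rewrite !scaleNr !scalerN !scalerA -!scaleNr -!scalerDl.
by apply: (f_equal4 (@block_mx R[i] k k k k));
  apply: (congr1 (fun x => x *: map_mx rc P)); apply/eqP; rewrite eq_complex /=;
  apply/andP; split; apply/eqP; ring.
Qed.

End JordanSplitting.

(** * Entrywise derivatives, uniqueness of solutions and the monodromy relation *)

Section MatrixDerivative.
Variable R : realType.

(** Entrywise, so that the differential equation in [fundamental_solution] is literally an
    instance. *)
Definition deriv_mx m n (X : R -> 'M[R]_(m, n)) (t : R) (D : 'M[R]_(m, n)) :=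
  forall i j, is_derive t 1 (fun s => X s i j) (D i j).

Lemma eq_deriv_mx m n (X Y : R -> 'M[R]_(m, n)) t DX DY :
  X =1 Y -> DX = DY -> deriv_mx X t DX -> deriv_mx Y t DY.
Proof. by move=> /funext -> ->. Qed.

Lemma is_derive_sum_fun (n : nat) (h : 'I_n -> R -> R) (t : R) (dh : 'I_n -> R) :
  (forall i, is_derive t 1 (h i) (dh i)) ->
  is_derive t 1 (fun s => \sum_(i < n) h i s) (\sum_(i < n) dh i).
Proof.
move=> hdh; rewrite (_ : (fun _ => _) = \sum_(i < n) h i); first exact: is_derive_sum.
by apply/funext => s; rewrite fct_sumE.
Qed.

Lemma is_deriveM_fun (f g : R -> R) (t df dg : R) :
  is_derive t 1 f df -> is_derive t 1 g dg ->
  is_derive t 1 (fun s => f s * g s) (df * g t + f t * dg).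
Proof.
move=> hf hg; rewrite (_ : df * _ + _ = f t *: dg + g t *: df).
  exact: (is_deriveM (f := f) (g := g)).
by rewrite addrC [df * _]mulrC.
Qed.

Lemma deriv_mxM m n p (X : R -> 'M[R]_(m, n)) (Y : R -> 'M[R]_(n, p)) t DX DY :
  deriv_mx X t DX -> deriv_mx Y t DY ->
  deriv_mx (fun s => X s *m Y s) t (DX *m Y t + X t *m DY).
Proof.
move=> hX hY i j.
rewrite (_ : (fun _ => _) = fun s => \sum_k X s i k * Y s k j); last first.
  by apply/funext => s; rewrite mxE.
rewrite !mxE -big_split /=; apply: is_derive_sum_fun => k.
exact: is_deriveM_fun.
Qed.

Lemma deriv_mxZ m n (f : R -> R) (X : R -> 'M[R]_(m, n)) (t df : R) DX :
  is_derive t 1 f df -> deriv_mx X t DX ->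
  deriv_mx (fun s => f s *: X s) t (df *: X t + f t *: DX).
Proof.
move=> hf hX i j.
rewrite (_ : (fun _ => _) = fun s => f s * X s i j); last first.
  by apply/funext => s; rewrite mxE.
by rewrite !mxE; exact: is_deriveM_fun.
Qed.

Lemma deriv_mx_cst m n (C : 'M[R]_(m, n)) t : deriv_mx (fun=> C) t 0.
Proof. by move=> i j; rewrite mxE; exact: is_derive_cst. Qed.

Lemma deriv_mxN m n (X : R -> 'M[R]_(m, n)) t DX :
  deriv_mx X t DX -> deriv_mx (fun s => - X s) t (- DX).
Proof.
move=> hX i j; rewrite (_ : (fun _ => _) = - (fun s => X s i j)); last first.
  by apply/funext => s; rewrite mxE.
by rewrite mxE; exact: is_deriveN.
Qed.

Lemma deriv_mx_affine m n (X : R -> 'M[R]_(m, n)) a b t DX :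
  deriv_mx X (a * t + b) DX -> deriv_mx (fun s => X (a * s + b)) t (a *: DX).
Proof.
move=> hX i j; rewrite mxE mulrC.
have hg : is_derive t 1 (fun s : R => a * s + b) a.
  rewrite -[X in is_derive _ _ _ X]addr0.
  apply: (is_deriveD (f := fun s => a * s) (g := fun=> b)).
  rewrite -[X in is_derive _ _ _ X]mulr1.
  exact: (is_deriveZ (f := id)).
exact: (is_derive1_comp (f := fun s => X s i j) (g := fun s => a * s + b)).
Qed.

Lemma deriv_mx_block m1 m2 n1 n2 (X : R -> 'M[R]_(m1, n1)) (Y : R -> 'M[R]_(m1, n2))
    (Z : R -> 'M[R]_(m2, n1)) (W : R -> 'M[R]_(m2, n2)) t DX DY DZ DW :
  deriv_mx X t DX -> deriv_mx Y t DY -> deriv_mx Z t DZ -> deriv_mx W t DW ->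
  deriv_mx (fun s => block_mx (X s) (Y s) (Z s) (W s)) t (block_mx DX DY DZ DW).
Proof.
move=> hX hY hZ hW i j; rewrite -(fintype.splitK i) -(fintype.splitK j).
case: (fintype.split i) (fintype.split j) => i' [] j' /=.
- rewrite block_mxEul; have := hX i' j'; congr is_derive.
  by apply/funext => s; rewrite block_mxEul.
- rewrite block_mxEur; have := hY i' j'; congr is_derive.
  by apply/funext => s; rewrite block_mxEur.
- rewrite block_mxEdl; have := hZ i' j'; congr is_derive.
  by apply/funext => s; rewrite block_mxEdl.
- rewrite block_mxEdr; have := hW i' j'; congr is_derive.
  by apply/funext => s; rewrite block_mxEdr.
Qed.

Lemma deriv_mx0_cst m n (X : R -> 'M[R]_(m, n)) t s :
  (forall u, deriv_mx X u 0) -> X t = X s.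
Proof.
move=> hX; apply/matrixP => i j.
apply: (is_derive_0_is_cst (f := fun u => X u i j)) => u.
by have := hX u i j; rewrite mxE.
Qed.

Lemma derivableM_fun (f g : R -> R) (t : R) :
  derivable f t 1 -> derivable g t 1 -> derivable (fun s => f s * g s) t 1.
Proof. by move=> /derivableP df /derivableP dg; have [] := is_deriveM_fun df dg. Qed.

Lemma derivable_big_sum (I : Type) (r : seq I) (f : I -> R -> R) (t : R) :
  (forall i, derivable (f i) t 1) -> derivable (fun s => \sum_(i <- r) f i s) t 1.
Proof.
move=> df; elim: r => [|i r IH].
  under eq_fun do rewrite big_nil; exact: derivable_cst.
under eq_fun do rewrite big_cons; exact: (derivableD (df i) IH).
Qed.

Lemma derivable_big_prod (I : Type) (r : seq I) (f : I -> R -> R) (t : R) :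
  (forall i, derivable (f i) t 1) -> derivable (fun s => \prod_(i <- r) f i s) t 1.
Proof.
move=> df; elim: r => [|i r IH].
  under eq_fun do rewrite big_nil; exact: derivable_cst.
under eq_fun do rewrite big_cons; exact: (derivableM_fun (df i) IH).
Qed.

Lemma derivable_det n (X : R -> 'M[R]_n) t :
  (forall i j, derivable (fun s => X s i j) t 1) ->
  derivable (fun s => \det (X s)) t 1.
Proof.
move=> dX; apply: derivable_big_sum => /= p.
apply: derivableM_fun; first exact: derivable_cst.
by apply: derivable_big_prod.
Qed.

Lemma derivable_invmx n (X : R -> 'M[R]_n) t :
  (forall s, X s \in unitmx) ->
  (forall i j, derivable (fun s => X s i j) t 1) ->
  forall i j, derivable (fun s => invmx (X s) i j) t 1.
Proof.
move=> uX dX i j.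
(* Cramer's rule: the entries of the inverse are cofactors divided by the determinant. *)
rewrite (_ : (fun _ => _) = fun s => (\det (X s))^-1 * cofactor (X s) j i).
  apply: derivableM_fun.
    apply: derivableV; last exact: derivable_det.
    by have := uX t; rewrite unitmxE unitfE.
  apply: derivableM_fun; first exact: derivable_cst.
  apply: derivable_det => a b.
  rewrite (_ : (fun _ => _) = fun s => X s (lift j a) (lift i b)) //.
  by apply/funext => s; rewrite !mxE.
by apply/funext => s; rewrite /invmx uX !mxE.
Qed.

Lemma deriv_mx_invmx n (X : R -> 'M[R]_n) t :
  (forall s, X s \in unitmx) -> (forall s, exists D, deriv_mx X s D) ->
  exists D, deriv_mx (fun s => invmx (X s)) t D.
Proof.
move=> uX dX; exists (\matrix_(i, j) 'D_1 (fun s => invmx (X s) i j) t) => i j.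
rewrite mxE; apply: derivableP; apply: derivable_invmx => // a b.
by have [D /(_ a b)[]] := dX t.
Qed.

(** The product of the inverse of [Phi] with [Psi] has derivative zero, so it keeps its value at
    0. *)
Lemma fundamental_solution_unique n (A Phi Psi : R -> 'M[R]_n) t :
  fundamental_solution A Phi -> (forall s, deriv_mx Psi s (A s *m Psi s)) ->
  Psi t = Phi t *m (invmx (Phi 0) *m Psi 0).
Proof.
move=> [uPhi dPhi] dPsi.
have cst s : deriv_mx (fun u => invmx (Phi u) *m Psi u) s 0.
  have [D dI] := deriv_mx_invmx s uPhi (fun u => ex_intro _ _ (dPhi u)).
  (* Differentiate both sides of Phi (Phi^-1 Psi) = Psi. *)
  have dX := deriv_mxM dI (dPsi s); set DX := (D *m _ + _) in dX.
  suff -> : 0 = DX by [].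
  have := deriv_mxM (dPhi s) dX.
  rewrite (_ : (fun _ => _) = Psi); last first.
    by apply/funext => u; rewrite mulKVmx.
  move=> dPsi'; have E : A s *m Psi s = A s *m Psi s + Phi s *m DX.
    apply/matrixP => i j; have [_ <-] := dPsi s i j; have [_ ->] := dPsi' i j.
    by rewrite -mulmxA mulKVmx.
  have : Phi s *m DX = 0 by apply: (addrI (A s *m Psi s)); rewrite addr0 -E.
  by move/(congr1 (mulmx (invmx (Phi s)))); rewrite mulKmx // mulmx0.
by rewrite (deriv_mx0_cst 0 t cst) mulKVmx.
Qed.

(** By periodicity of [A], the translate of [Phi] by [T] solves the same system, and its value at 0
    is [Phi T]. *)
Lemma monodromyP n (A Phi : R -> 'M[R]_n) (T t : R) :
  fundamental_solution A Phi -> (forall t, A (t + T) = A t) ->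
  Phi (t + T) = Phi t *m monodromy Phi T.
Proof.
move=> fPhi AT; have [uPhi dPhi] := fPhi.
rewrite (fundamental_solution_unique t (Psi := fun t => Phi (t + T)) fPhi).
  by rewrite /monodromy add0r.
move=> s; have := @deriv_mx_affine _ _ Phi 1 T s (A (s + T) *m Phi (s + T)).
rewrite !mul1r scale1r => /(_ (dPhi (s + T))); rewrite AT.
by apply: eq_deriv_mx => // u; rewrite mul1r.
Qed.

End MatrixDerivative.

(** * The matrix exponential: convergence, derivative and group law *)

Section MatrixExponential.
Variable R : realType.

Lemma norm_mx_exp_le n (B : 'M[R]_n) k i j :
  `|(B ^+ k) i j| <= (\sum_a \sum_b `|B a b|) ^+ k.
Proof.
set b := \sum_a _; elim: k i j => [|k IHk] i j.
  by rewrite !expr0 mxE; case: (i == j); rewrite ?normr1 ?normr0.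
rewrite exprSr -mulmxE mxE (le_trans (ler_norm_sum _ _ _)) //.
rewrite exprSr mulr_sumr; apply: ler_sum => c _.
rewrite normrM ler_pM //.
by rewrite (bigD1 j) //= lerDl sumr_ge0.
Qed.

(** Comparison with [b ^+ p] times the scalar exponential series at [b * |x|], where [b] is the sum
    of the absolute values of the entries. The shift [p] covers the termwise derivatives, each of
    which raises it by one. *)
Lemma cvg_mx_pseries n (B : 'M[R]_n) p i j (x : R) :
  cvgn (pseries (fun k => k`!%:R^-1 * (B ^+ (k + p)) i j) x).
Proof.
set b := \sum_a \sum_c `|B a c|.
have b0 : 0 <= b by apply: sumr_ge0 => a _; apply: sumr_ge0.
apply: normed_cvg; apply: (@series_le_cvg _ _ (fun k => b ^+ p * exp_coeff (b * `|x|) k)).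
- by move=> k /=.
- by move=> k; rewrite mulr_ge0 ?exprn_ge0 // exp_coeff_ge0 // mulr_ge0.
- move=> k /=; rewrite /exp_coeff /= !normrM normrX normfV normr_nat exprMn.
  rewrite [leRHS](_ : _ = k`!%:R^-1 * (b ^+ (k + p)) * `|x| ^+ k); last first.
    by rewrite exprD; ring.
  by rewrite ler_wpM2r ?exprn_ge0 // ler_wpM2l ?invr_ge0 // norm_mx_exp_le.
- rewrite (_ : series _ = (fun N => b ^+ p * series (exp_coeff (b * `|x|)) N)).
    by apply: is_cvgZr; exact: is_cvg_series_exp_coeff.
  by apply/funext => N; rewrite /series /= mulr_sumr.
Qed.

Definition mx_exp_coeff n (B : 'M[R]_n) i j k : R := k`!%:R^-1 * (B ^+ k) i j.

Lemma cvg_mx_exp_coeff n (B : 'M[R]_n) i j (x : R) :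
  cvgn (pseries (mx_exp_coeff B i j) x).
Proof.
rewrite (_ : mx_exp_coeff B i j = fun k => k`!%:R^-1 * (B ^+ (k + 0)) i j).
  exact: cvg_mx_pseries.
by apply/funext => k; rewrite addn0.
Qed.

Lemma exprZmx n (B : 'M[R]_n) t k : (t *: B) ^+ k = t ^+ k *: B ^+ k.
Proof.
elim: k => [|k IHk]; first by rewrite !expr0 scale1r.
by rewrite !exprS IHk -!mulmxE -scalemxAl -scalemxAr scalerA.
Qed.

(** Makes each entry a scalar power series in [t], to which termwise differentiation applies. *)
Lemma expmxZE n (B : 'M[R]_n) t i j :
  expmx (t *: B) i j = limn (pseries (mx_exp_coeff B i j) t).
Proof.
rewrite mxE; congr (limn _); apply/funext => N.
rewrite /pseries /series /= summxE big_mkord; apply: eq_bigr => k _.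
by rewrite exprZmx !mxE /mx_exp_coeff; ring.
Qed.

Lemma mx_exp_coeff_diffs n (B : 'M[R]_n) p i j :
  pseries_diffs (fun k => k`!%:R^-1 * (B ^+ (k + p)) i j) =
  (fun k => k`!%:R^-1 * (B ^+ (k + p.+1)) i j).
Proof.
apply/funext => k; rewrite /pseries_diffs factS natrM invfM addSnnS !mulrA.
by rewrite divff ?pnatr_eq0 // mul1r.
Qed.

(** The series on the right is the termwise derivative of the exponential. The product in the other
    order, computed next, gives the same series, whence commutation. *)
Lemma mul_expmxE n (B : 'M[R]_n) t i j :
  (B *m expmx (t *: B)) i j =
  limn (pseries (fun k => k`!%:R^-1 * (B ^+ k.+1) i j) t).
Proof.
apply/esym/cvg_lim => //; rewrite mxE.
rewrite (_ : pseries _ t =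
    (fun N => \sum_l B i l * pseries (mx_exp_coeff B l j) t N)); last first.
  apply/funext => N; rewrite /pseries /series /=.
  under [RHS]eq_bigr do rewrite mulr_sumr.
  rewrite exchange_big /=; apply: eq_bigr => k _.
  rewrite exprS -mulmxE mxE mulr_sumr mulr_suml; apply: eq_bigr => l _.
  by rewrite /mx_exp_coeff; ring.
apply: cvg_big => [|l _]; first exact: add_continuous.
rewrite expmxZE; apply: cvgM; first exact: cvg_cst.
exact: cvg_mx_exp_coeff.
Qed.

Lemma expmx_mulE n (B : 'M[R]_n) t i j :
  (expmx (t *: B) *m B) i j =
  limn (pseries (fun k => k`!%:R^-1 * (B ^+ k.+1) i j) t).
Proof.
apply/esym/cvg_lim => //; rewrite mxE.
rewrite (_ : pseries _ t =
    (fun N => \sum_l pseries (mx_exp_coeff B i l) t N * B l j)); last first.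
  apply/funext => N; rewrite /pseries /series /=.
  under [RHS]eq_bigr do rewrite mulr_suml.
  rewrite exchange_big /=; apply: eq_bigr => k _.
  rewrite exprSr -mulmxE mxE mulr_sumr mulr_suml; apply: eq_bigr => l _.
  by rewrite /mx_exp_coeff; ring.
apply: cvg_big => [|l _]; first exact: add_continuous.
rewrite expmxZE; apply: cvgM; last exact: cvg_cst.
exact: cvg_mx_exp_coeff.
Qed.

Lemma expmx_comm n (B : 'M[R]_n) t : B *m expmx (t *: B) = expmx (t *: B) *m B.
Proof. by apply/matrixP => i j; rewrite mul_expmxE expmx_mulE. Qed.

Lemma expmx0 n : expmx (0 : 'M[R]_n) = 1%:M.
Proof.
apply/matrixP => i j; rewrite mxE; apply: cvg_lim => //.
(* The empty partial sum is 0; only from the first term on are the partial sums constant. *)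
rewrite -(cvg_shiftS _ _) /=.
apply: cvg_near_cst; apply: nearW => N.
rewrite big_ord_recl /= expr0 fact0 invr1 scale1r big1 ?addr0 // => k _.
by rewrite exprS mul0r scaler0.
Qed.

Lemma deriv_expmx n (B : 'M[R]_n) t :
  deriv_mx (fun s => expmx (s *: B)) t (B *m expmx (t *: B)).
Proof.
move=> i j; rewrite mul_expmxE.
rewrite (_ : (fun _ => _) = fun s => limn (pseries (mx_exp_coeff B i j) s)); last first.
  by apply/funext => s; rewrite expmxZE.
have d0 : mx_exp_coeff B i j = fun k => k`!%:R^-1 * (B ^+ (k + 0)) i j.
  by apply/funext => k; rewrite addn0.
have d1 : pseries_diffs (mx_exp_coeff B i j) = fun k => k`!%:R^-1 * (B ^+ (k + 1)) i j.
  by rewrite d0 mx_exp_coeff_diffs.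
rewrite (_ : (fun k => _) = pseries_diffs (mx_exp_coeff B i j)); last first.
  by rewrite d1; apply/funext => k; rewrite addn1.
(* Any point of absolute value above that of [t] would do: the series and its first two termwise
   derivatives converge everywhere. *)
apply: (@pseries_snd_diffs _ _ (`|t| + 1)).
- exact: cvg_mx_exp_coeff.
- by rewrite d1; exact: cvg_mx_pseries.
- by rewrite d1 mx_exp_coeff_diffs; exact: cvg_mx_pseries.
- by rewrite [ltRHS]ger0_norm ?ltrDl // addr_ge0.
Qed.

(** The left-hand side is constant in [t]: the two terms of its derivative cancel because [B]
    commutes with its exponential. *)
Lemma expmxN_flow n (B : 'M[R]_n) (X : R -> 'M[R]_n) t :
  (forall s, deriv_mx X s (B *m X s)) -> expmx ((- t) *: B) *m X t = X 0.
Proof.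
move=> dX; pose Y s := expmx ((- s) *: B) *m X s.
have dY s : deriv_mx Y s 0.
  have h := @deriv_mx_affine R _ _ (fun s => expmx (s *: B)) (-1) 0 s _ (deriv_expmx B _).
  apply: eq_deriv_mx (deriv_mxM h (dX s)) => [u|]; first by rewrite mulN1r addr0.
  by rewrite mulN1r addr0 scaleN1r mulNmx expmx_comm mulmxA addNr.
by rewrite -/(Y t) (deriv_mx0_cst t 0 dY) /Y oppr0 scale0r expmx0 mul1mx.
Qed.

Lemma expmxNK n (B : 'M[R]_n) t : expmx ((- t) *: B) *m expmx (t *: B) = 1%:M.
Proof.
by rewrite (expmxN_flow (X := fun s => expmx (s *: B))) ?scale0r ?expmx0 //; exact: deriv_expmx.
Qed.

Lemma expmx_flow n (B : 'M[R]_n) (X : R -> 'M[R]_n) t :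
  (forall s, deriv_mx X s (B *m X s)) -> X t = expmx (t *: B) *m X 0.
Proof.
move=> dX; have E := expmxNK B (- t); rewrite opprK in E.
by rewrite -(expmxN_flow t dX) mulmxA E mul1mx.
Qed.

(** As a function of [s], the left-hand side is a flow of [B] with value [expmx (t *: B)] at 0. *)
Lemma expmxD n (B : 'M[R]_n) s t :
  expmx ((s + t) *: B) = expmx (s *: B) *m expmx (t *: B).
Proof.
rewrite (expmx_flow (B := B) (X := fun s => expmx ((s + t) *: B)) s) ?add0r //.
move=> u.
have := @deriv_mx_affine R _ _ (fun s => expmx (s *: B)) 1 t u _ (deriv_expmx B _).
by apply: eq_deriv_mx => [v|]; rewrite ?scale1r mul1r.
Qed.

End MatrixExponential.

(** * Real matrices whose exponentials have prescribed Jordan blocks *)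

Section JordanExponential.
Variable R : realType.
Local Notation rc := (real_complex R).

(** Reduces the computation of an exponential to guessing a flow that starts at the identity. *)
Lemma expmx_flow1 n (B : 'M[R]_n) (X : R -> 'M[R]_n) :
  (forall s, deriv_mx X s (B *m X s)) -> X 0 = 1%:M -> expmx B = X 1.
Proof. by move=> dX X0; rewrite (expmx_flow 1 dX) scale1r X0 mulmx1. Qed.

Lemma expmx_dsum n1 n2 (B1 : 'M[R]_n1) (B2 : 'M[R]_n2) :
  expmx (dsum B1 B2) = dsum (expmx B1) (expmx B2).
Proof.
rewrite (expmx_flow1 (X := fun t => dsum (expmx (t *: B1)) (expmx (t *: B2)))).
- by rewrite !scale1r.
- move=> t; apply: eq_deriv_mx (deriv_mx_block (deriv_expmx B1 t)
    (deriv_mx_cst 0 t) (deriv_mx_cst 0 t) (deriv_expmx B2 t)) => [//|].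
  by rewrite mulmx_block !mulmx0 !mul0mx !addr0 !add0r.
- by rewrite !scale0r !expmx0 [RHS]scalar_mx_block.
Qed.

(** The exponential of [t *: jb 0 k], written out. The test matters because truncated subtraction
    would put ones below the diagonal. *)
Definition jflow k (t : R) : 'M[R]_k :=
  \matrix_(a, b) (if (a <= b)%N then t ^+ (b - a) / (b - a)`!%:R else 0).

Lemma is_derive_exprn n (t : R) :
  is_derive t 1 (fun s => s ^+ n.+1) (n.+1%:R * t ^+ n).
Proof.
elim: n => [|n IHn]; first by rewrite expr0 mulr1; exact: is_derive_id.
have := is_deriveM_fun (@is_derive_id _ _ t 1) IHn.
rewrite (_ : (fun s => s * s ^+ n.+1) = (fun s => s ^+ n.+2)); last first.
  by apply/funext => s; rewrite -exprS.
rewrite (_ : 1 * _ + _ = n.+2%:R * t ^+ n.+1) //.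
by rewrite -natr1 exprS; ring.
Qed.

Lemma jflow0 k : jflow k 0 = 1%:M.
Proof.
apply/matrixP => a b; rewrite !mxE -val_eqE /=.
case: ltngtP => [ab|ab|->] //; last by rewrite subnn expr0 divr1.
by rewrite expr0n subn_eq0 leqNgt ab mul0r.
Qed.

Lemma deriv_jflow k t : deriv_mx (jflow k) t (jb 0 k *m jflow k t).
Proof.
move=> a b.
(* Multiplication by the nilpotent block moves every row up by one and clears the last row. *)
have -> : (jb 0 k *m jflow k t) a b =
    if (a < b)%N then t ^+ (b - a.+1) / (b - a.+1)`!%:R else 0.
  rewrite mxE; have [lta|gea] := ltnP a.+1 k.
    rewrite (bigD1 (Ordinal lta)) //= big1 => [|c nc].
      by rewrite !mxE -val_eqE /= ltn_eqF // eqxx mul1r addr0.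
    rewrite mxE; case: eqP => _; rewrite ?mul0r //.
    by rewrite (_ : (_ == _) = false) ?mul0r //; apply: negbTE.
  rewrite big1 => [|c _].
    by case: ltnP => // ab; have := ltn_ord b; lia.
  rewrite !mxE; case: eqP => _; rewrite ?mul0r //.
  by case: eqP => //= e; rewrite ?mul0r //; have := ltn_ord c; lia.
have [ab|ba|ab] := ltngtP a b.
- rewrite (_ : (fun _ => _) = fun s => s ^+ (b - a.+1).+1 * (b - a)`!%:R^-1); last first.
    by apply/funext => s; rewrite mxE (ltnW ab) subnSK.
  apply: (is_derive_eq (is_deriveM_fun (is_derive_exprn (b - a.+1) t)
    (is_derive_cst ((b - a)`!%:R^-1 : R) t 1))).
  rewrite /= mulr0 addr0 -(subnSK ab) factS natrM.
  by rewrite invfM mulrACA divff ?pnatr_eq0 // mul1r.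
- rewrite (_ : (fun _ => _) = fun=> 0); first exact: is_derive_cst.
  by apply/funext => s; rewrite mxE leqNgt ba.
- rewrite (_ : (fun _ => _) = fun=> 1); first exact: is_derive_cst.
  by apply/funext => s; rewrite mxE ab leqnn subnn expr0 divr1.
Qed.

Lemma is_derive_linear (a t : R) : is_derive t 1 (fun s : R => a * s) a.
Proof.
rewrite -[X in is_derive _ _ _ X]mulr1.
exact: (is_deriveZ (f := id)).
Qed.

Lemma is_derive_expR_cos (a b t : R) :
  is_derive t 1 (fun s => expR (a * s) * cos (b * s))
    (a * (expR (a * t) * cos (b * t)) - b * (expR (a * t) * sin (b * t))).
Proof.
have de := is_derive1_comp (f := @expR R) (is_derive_expR _) (is_derive_linear a t).
have dc := is_derive1_comp (f := @cos R) (is_derive_cos _) (is_derive_linear b t).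
apply: (is_derive_eq (is_deriveM_fun de dc)) => /=; ring.
Qed.

Lemma is_derive_expR_sin (a b t : R) :
  is_derive t 1 (fun s => expR (a * s) * sin (b * s))
    (a * (expR (a * t) * sin (b * t)) + b * (expR (a * t) * cos (b * t))).
Proof.
have de := is_derive1_comp (f := @expR R) (is_derive_expR _) (is_derive_linear a t).
have ds := is_derive1_comp (f := @sin R) (is_derive_sin _) (is_derive_linear b t).
apply: (is_derive_eq (is_deriveM_fun de ds)) => /=; ring.
Qed.

Lemma jbE (F : fieldType) (l : F) k : jb l k = l%:M + jb 0 k.
Proof. by rewrite -[l in RHS]opprK raddfN /= addrC jb_shift opprK add0r. Qed.

Lemma expmx_jb (a : R) k : expmx (jb a k) = expR a *: jflow k 1.
Proof.
rewrite (expmx_flow1 (X := fun t => expR (a * t) *: jflow k t)).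
- by rewrite mulr1.
- move=> t.
  have de := is_derive1_comp (f := @expR R) (is_derive_expR _) (is_derive_linear a t).
  have h := deriv_mxZ de (@deriv_jflow k t).
  apply: eq_deriv_mx h => [//|] /=.
  by rewrite (jbE a) mulmxDl mul_scalar_mx -scalemxAr scalerA mulrC.
- by rewrite mulr0 expR0 scale1r jflow0.
Qed.

(** The argument is the real form of a complex Jordan block with eigenvalue a + ib, and the result
    is the real form of e^(a + ib) times [jflow k 1]. *)
Lemma expmx_rotation (a b : R) k :
  expmx (block_mx (jb a k) (- b)%:M b%:M (jb a k)) =
  block_mx ((expR a * cos b) *: jflow k 1) (- ((expR a * sin b) *: jflow k 1))
           ((expR a * sin b) *: jflow k 1) ((expR a * cos b) *: jflow k 1).
Proof.
pose C t := (expR (a * t) * cos (b * t)) *: jflow k t.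
pose S t := (expR (a * t) * sin (b * t)) *: jflow k t.
have dC t := deriv_mxZ (is_derive_expR_cos a b t) (@deriv_jflow k t).
have dS t := deriv_mxZ (is_derive_expR_sin a b t) (@deriv_jflow k t).
rewrite (expmx_flow1 (X := fun t => block_mx (C t) (- S t) (S t) (C t))).
- by rewrite /C /S !mulr1.
- move=> t; apply: eq_deriv_mx (deriv_mx_block (dC t) (deriv_mxN (dS t)) (dS t) (dC t)) => [//|].
  rewrite mulmx_block (jbE a) !mulmxDl !mul_scalar_mx !mulmxN /C /S -!scalemxAr !scalerA.
  rewrite !scalerN !scalerA !scalerDl !scaleNr !mulNr !scaleNr ?opprK.
  congr block_mx; rewrite ?opprD.
  + by rewrite addrAC.
  + by rewrite addrAC.
  + by rewrite [RHS]addrCA addrA.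
  + by rewrite [RHS]addrCA addrA.
- rewrite /C /S !mulr0 sin0 cos0 expR0 !mulr1 !mulr0 scale1r scale0r oppr0.
  by rewrite jflow0 -scalar_mx_block.
Qed.

(** The superdiagonal of [jflow k 1] consists of ones, so after scaling it consists of [l], which is
    nonzero. *)
Lemma simm_jflow k (l : R[i]) : l != 0 ->
  simm (l *: map_mx rc (jflow k 1)) (jb l k).
Proof.
move=> l0; apply: simm_jb_utri => [a b ba|a|a b ab]; rewrite !mxE.
- by rewrite leqNgt ba rmorph0 mulr0.
- by rewrite leqnn subnn expr0 divr1 rmorph1 mulr1.
- by rewrite ab leqnSn subSnn expr1n divr1 rmorph1 mulr1.
Qed.

Lemma polar (l : R[i]) : l != 0 ->
  exists a b : R, l = (expR a * cos b +i* (expR a * sin b))%C.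
Proof.
case: l => x y; rewrite eq_complex /= negb_and => xy0.
pose r := Num.sqrt (x ^+ 2 + y ^+ 2).
have r2 : r ^+ 2 = x ^+ 2 + y ^+ 2 by rewrite sqr_sqrtr // addr_ge0 ?sqr_ge0.
have r0 : 0 < r.
  rewrite sqrtr_gt0 lt_neqAle addr_ge0 ?sqr_ge0 // andbT eq_sym.
  by rewrite paddr_eq0 ?sqr_ge0 // !sqrf_eq0 negb_and.
have rE : expR (ln r) = r by rewrite lnK // posrE.
have xr2 : (x / r) ^+ 2 + (y / r) ^+ 2 = 1.
  by rewrite !expr_div_n -mulrDl -r2 divff // sqrf_eq0 gt_eqF.
have xr : -1 <= x / r <= 1.
  rewrite -ler_norml -(@ler_pXn2r _ 2) ?nnegrE // expr1n real_normK ?num_real //.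
  by rewrite -xr2 lerDl sqr_ge0.
have cosr : cos (acos (x / r)) = x / r by rewrite acosK // in_itv.
have sinr : sin (acos (x / r)) = `|y| / r.
  rewrite sin_acos // (_ : 1 - _ = (y / r) ^+ 2); last by rewrite -xr2 addrC addKr.
  by rewrite sqrtr_sqr normrM normfV (gtr0_norm r0).
have rn0 : r != 0 by rewrite gt_eqF.
(* The sine is nonnegative on the range of [acos], so a negative [y] takes the opposite angle. *)
have [y0|y0] := leP 0 y; [exists (ln r), (acos (x / r))|exists (ln r), (- acos (x / r))].
  by rewrite rE cosr sinr (ger0_norm y0) ![r * _]mulrC !divfK.
by rewrite rE cosN sinN cosr sinr (ltr0_norm y0) mulNr opprK ![r * _]mulrC !divfK.
Qed.

(** A real logarithm up to the factor [s], stated for the Jordan form. It is applied with [s] equal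
    to 1 for positive blocks and conjugate pairs, and to -1 for the unpaired negative blocks. *)
Definition slog (s : R) (L : seq (R[i] * nat)) := exists n (B : 'M[R]_n),
  simm (map_mx rc (s *: expmx B)) (jmx L).

Lemma slog_nil s : slog s [::].
Proof. by exists 0%N, 0; exact: simm_dim0. Qed.

Lemma slog_cat s L1 L2 : slog s L1 -> slog s L2 -> slog s (L1 ++ L2).
Proof.
move=> [n1 [B1 h1]] [n2 [B2 h2]]; exists (n1 + n2)%N, (dsum B1 B2).
apply: simm_trans (simm_sym (simm_jmx_cat _ _)).
apply: simm_trans (simm_dsum h1 h2).
by rewrite expmx_dsum -map_dsum /dsum scale_block_mx !scaler0; exact: simm_refl.
Qed.

Lemma slog_perm s L1 L2 : perm_eq L1 L2 -> slog s L1 -> slog s L2.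
Proof.
by move=> p [n [B h]]; exists n, B; exact: simm_trans h (simm_jmx_perm p).
Qed.

Lemma slog_real s (L : seq (R[i] * nat)) :
  all (fun p => (complex.Im p.1 == 0) && (0 < s * complex.Re p.1)) L -> slog s L.
Proof.
elim: L => [|[[x y] k] L IH] /=; first by move=> _; exact: slog_nil.
move=> /andP[/andP[/eqP /= -> sx] /IH hL].
rewrite -cat1s; apply: slog_cat hL.
have s0 : s != 0 by apply: contraTneq sx => ->; rewrite mul0r ltxx.
have x0 : x != 0 by apply: contraTneq sx => ->; rewrite mulr0 ltxx.
have xs : 0 < x / s.
  rewrite (_ : x / s = s * x / s ^+ 2) ?divr_gt0 ?exprn_even_gt0 //.
  by field.
(* The factor [s] times the exponential of [ln (x / s)] is the eigenvalue [x]. *)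
exists k, (jb (ln (x / s)) k).
rewrite expmx_jb lnK ?posrE // scalerA mulrC divfK // map_mxZ /=.
apply: simm_trans (simm_jflow k _) _; first by rewrite eq_complex /= eqxx andbT.
rewrite -[_%:C%C]/(x +i* 0)%C.
apply: simm_trans (simm_dsumC _ _); exact/simm_sym/simm_dsum0.
Qed.

(** Writing [l] as e^(a + ib) makes the pair the complex form of a real rotation block. This
    includes negative [l], where the pair consists of two equal blocks and the rotation is a
    half-turn. *)
Lemma slog_conj (U : seq (R[i] * nat)) :
  all (fun p => p.1 != 0) U -> slog 1 (U ++ [seq conjblock p | p <- U]).
Proof.
elim: U => [|[l k] U IH] /=; first by move=> _; exact: slog_nil.
move=> /andP[l0 /IH hU].
apply: (@slog_perm 1 ([:: (l, k); conjblock (l, k)] ++ (U ++ [seq conjblock p | p <- U]))).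
  rewrite /= perm_cons -cat1s -[X in perm_eq _ (_ ++ X)]cat1s perm_catCA.
  exact: perm_refl.
apply: slog_cat hU; have [a [b lE]] := polar l0.
exists (k + k)%N, (block_mx (jb a k) (- b)%:M b%:M (jb a k)).
rewrite scale1r expmx_rotation; apply: simm_trans (simm_rotation _ _ _) _.
rewrite -lE [X in dsum _ (X *: _)](_ : _ = conjc l); last by rewrite lE.
have lc0 : conjc l != 0 by rewrite fmorph_eq0.
apply: simm_dsum; first exact: simm_jflow.
apply: simm_trans (simm_jflow k lc0) _.
apply: simm_trans (simm_dsumC _ _); exact/simm_sym/simm_dsum0.
Qed.

End JordanExponential.

(** * The signed real logarithm of an invertible real matrix *)

Section SignedLogarithm.
Variable R : realType.
Local Notation rc := (real_complex R).

Lemma simm_jordan_mx m (lam : 'I_m -> R[i]) (sz : 'I_m -> nat) :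
  simm (jordan_mx lam sz) (jmx [seq (lam b, sz b) | b <- enum 'I_m]).
Proof.
elim: m lam sz => [|m IHm] lam sz.
  have e0 : (\sum_(b < 0) sz b = 0)%N by rewrite big_ord0.
  have -> : enum 'I_0 = [::] by apply: size0nil; rewrite size_enum_ord.
  move: (jordan_mx _ _); rewrite e0 => A; exact: simm_dim0.
rewrite /jordan_mx mxdiag_recl enum_ordSl map_cons -map_comp.
apply: simm_trans (simm_cast _ _) _.
apply: simm_dsum; first exact: simm_refl.
exact: (IHm (fun b => lam (lift ord0 b)) (fun b => sz (lift ord0 b))).
Qed.

Lemma is_jordan_form_simm n (M : 'M[R]_n) m (lam : 'I_m -> R[i]) (sz : 'I_m -> nat) :
  is_jordan_form M lam sz ->
  simm (map_mx rc M) (jmx [seq (lam b, sz b) | b <- enum 'I_m]).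
Proof.
move=> [_ [E [P [uP h]]]].
apply: simm_trans (simm_jordan_mx lam sz).
apply: simm_trans (simm_cast E _); rewrite -h.
exists P, (invmx P); split; [exact: mulmxV|exact: mulVmx|].
by rewrite !mulmxA mulmxV // mul1mx.
Qed.

(** A nonempty block with eigenvalue 0 would make the rank of the Jordan matrix smaller than its
    dimension. *)
Lemma simm_unit_jmx n (M : 'M[R[i]]_n) L : M \in unitmx -> simm M (jmx L) ->
  all (fun p => 0 < p.2)%N L -> all (fun p => p.1 != 0) L.
Proof.
move=> uM MJ posL; have rJ : \rank (jmx L) = jdim L.
  by rewrite -(simm_rank MJ) mxrank_unit // (simm_dim MJ).
have := rank_jmx_shift_exp L 0 1; rewrite expr1 raddf0 subr0 rJ jdimE => E.
apply/allP => p pL; apply/negP => /eqP p0.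
have : (\sum_(q <- L) (if q.1 == 0%R then q.2 - 1 else q.2) < \sum_(q <- L) q.2)%N.
  rewrite !(big_rem p pL) /= p0 eqxx -addSn leq_add //.
    by rewrite subn1 prednK // (allP posL).
  by apply: leq_sum => q _; case: ifP => _; rewrite ?leq_subr.
by rewrite -E ltnn.
Qed.

(** The size of [B2] is written as the sum in [aindex_of], so that the summand with the minus sign
    has the A-index as its dimension. *)
Lemma signed_real_log n (M : 'M[R]_n) L : M \in unitmx ->
  simm (map_mx rc M) (jmx L) -> all (fun p => 0 < p.2)%N L ->
  exists n1 (B1 : 'M[R]_n1)
    (B2 : 'M[R]_(\sum_(p <- undup L | negblock p && odd (count_mem p L)) p.2)),
    simm M (dsum (expmx B1) (- expmx B2)).
Proof.
move=> uM MJ posL.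
have uMC : map_mx rc M \in unitmx by rewrite map_unitmx.
have L0 := simm_unit_jmx uMC MJ posL.
(* Conjugation fixes the real matrix [M], so the conjugated list is a Jordan form of [M] as well,
   and uniqueness applies. *)
have Lconj : perm_eq L [seq conjblock p | p <- L].
  apply: simm_jmx_inj => //; first by rewrite all_map.
  apply: simm_trans (simm_sym MJ) _.
  have := simm_trans (simm_map (@conjc R) MJ) (simm_map_jmx (@conjc R) L).
  rewrite (_ : map_mx _ (map_mx rc M) = map_mx rc M) //.
  by apply/matrixP => i j; rewrite !mxE /= oppr0.
have [G [U [D [[pL posG U0 negD] [uD DE]]]]] := jordan_split L0 Lconj.
have [n1 [B1 h1]] : slog 1 (G ++ U ++ [seq conjblock p | p <- U]).
  apply: slog_cat (slog_conj U0); apply: slog_real.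
  by apply: sub_all posG => p; rewrite mul1r.
have [n2 [B2 h2]] : slog (-1) D.
  apply: slog_real; apply: sub_all negD => p.
  by rewrite mulN1r oppr_gt0.
(* Both [D] and the filtered [undup L] are free of duplicates and have the same members. *)
have <- : n2 = (\sum_(p <- undup L | negblock p && odd (count_mem p L)) p.2)%N.
  rewrite (simm_dim h2) jdimE -[RHS]big_filter; apply: perm_big.
  apply: uniq_perm => // [|p]; first by rewrite filter_uniq ?undup_uniq.
  rewrite DE mem_filter mem_undup; case: (boolP (p \in L)) => pL'; rewrite ?andbT //.
  by rewrite (count_memPn pL') /= !andbF.
exists n1, B1, B2; apply: simm_complex_real.
apply: simm_trans MJ _; apply: simm_trans (simm_jmx_perm pL) _.
apply: simm_trans (simm_jmx_cat _ _) _; apply: simm_sym.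
rewrite map_dsum -[expmx B1]scale1r -scaleN1r; exact: simm_dsum.
Qed.

Lemma sign_block_dsum n1 n2 : sign_block R (n1 + n2) n2 = dsum 1%:M (- 1%:M).
Proof.
apply/matrixP => i j; rewrite mxE addnK.
case: (fintype.splitP i) => i' ei; case: (fintype.splitP j) => j' ej.
- have -> : i = lshift n2 i' by apply: val_inj.
  have -> : j = lshift n2 j' by apply: val_inj.
  by rewrite block_mxEul mxE -!val_eqE /=; case: eqP.
- have -> : i = lshift n2 i' by apply: val_inj.
  have -> : j = rshift n1 j' by apply: val_inj.
  by rewrite block_mxEur mxE -!val_eqE /= ltn_eqF // ltn_addr.
- have -> : i = rshift n1 i' by apply: val_inj.
  have -> : j = lshift n2 j' by apply: val_inj.
  by rewrite block_mxEdl mxE -!val_eqE /= gtn_eqF // ltn_addr.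
- have -> : i = rshift n1 i' by apply: val_inj.
  have -> : j = rshift n1 j' by apply: val_inj.
  rewrite block_mxEdr !mxE -!val_eqE /= eqn_add2l.
  by case: eqP => //; rewrite oppr0.
Qed.

End SignedLogarithm.

(** * Assembly of the real Floquet factorization *)

Theorem theoremA (R : realType) (n : nat) (T : R) (A : R -> 'M[R]_n)
  (d : nat) :
  0 < T ->
  (forall i j : 'I_n, continuous (fun t : R => A t i j)) ->
  (forall t : R, A (t + T) = A t) ->
  (exists (Phi0 : R -> 'M[R]_n) (m : nat) (lam : 'I_m -> R[i])
          (sz : 'I_m -> nat),
      fundamental_solution A Phi0 /\
      is_jordan_form (monodromy Phi0 T) lam sz /\
      d = aindex_of lam sz) ->
  exists (Rm : 'M[R]_n) (Q : R -> 'M[R]_n),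
    fundamental_solution A (fun t => Q t *m expmx (t *: Rm)) /\
    (forall t : R, Q (t + T) = Q t *m sign_block R n d).
Proof.
move=> T0 _ AT [Phi [m [lam [sz [fPhi [jM dE]]]]]].
have [uPhi dPhi] := fPhi.
set M := monodromy Phi T in jM; set L := [seq (lam b, sz b) | b <- enum 'I_m].
have uM : M \in unitmx by rewrite unitmx_mul unitmx_inv !uPhi.
have posL : all (fun p => 0 < p.2)%N L.
  by case: jM => szpos _; apply/allP => p /mapP[b _ ->]; exact: szpos.
have [n1 [B1 [B2]]] := signed_real_log uM (is_jordan_form_simm jM) posL.
have {dE} : d = (\sum_(p <- undup L | negblock p && odd (count_mem p L)) p.2)%N.
  by rewrite dE.
(* Once the sum is the variable [n2], both [d] and [n] can be substituted, and all matrices have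
   size [n1 + n2] without casts. *)
move: B2; move: (\sum_(p <- _ | _) _)%N => n2 B2 dE MB; subst d.
have nE := simm_dim MB.
have PhiT t := monodromyP t fPhi AT; rewrite -/M in PhiT.
clear jM L posL.
move: MB PhiT; move: M uM; subst n => M uM [S [S' [SS' S'S MS]]] PhiT.
pose B := dsum B1 B2; pose J := sign_block R (n1 + n2) n2.
have Tn0 : T != 0 by rewrite gt_eqF.
have KE : dsum (expmx B1) (- expmx B2) = J *m expmx B.
  rewrite /J sign_block_dsum expmx_dsum mulmx_block.
  by rewrite !mulmx0 !mul0mx !addr0 !add0r !mul1mx mulNmx mul1mx.
(* On each of the two summands of [B], the matrix [J] is a scalar. *)
have JB t : J *m expmx (t *: B) = expmx (t *: B) *m J.
  rewrite /J sign_block_dsum /B /dsum scale_block_mx !scaler0 -dsumE expmx_dsum.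
  rewrite !mulmx_block !mulmx0 !mul0mx !addr0 !add0r !mul1mx !mulmx1.
  by rewrite mulNmx mulmxN mul1mx mulmx1.
exists (T^-1 *: B), (fun t => Phi t *m S *m expmx ((- (t / T)) *: B)); split.
  (* The exponentials cancel, and [Phi t *m S] remains, a fundamental solution because [S] is
     constant and invertible. *)
  rewrite (_ : (fun t => _) = fun t => Phi t *m S); last first.
    apply/funext => t; rewrite -mulmxA scalerA expmxNK mulmx1 //.
  split=> [t|t]; first by rewrite unitmx_mul uPhi; case: (mulmx1_unit SS').
  apply: eq_deriv_mx (deriv_mxM (dPhi t) (deriv_mx_cst S t)) => //.
  by rewrite mulmx0 addr0 mulmxA.
move=> t; have E : expmx B *m expmx ((- ((t + T) / T)) *: B) = expmx ((- (t / T)) *: B).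
  have := expmxD B 1 (- ((t + T) / T)); rewrite scale1r => <-.
  by rewrite mulrDl divff // opprD addrC subrK.
(* The chain is Phi(t) M S e^(-(t+T)B/T) = Phi(t) S J e^B e^(-(t+T)B/T) = Phi(t) S J e^(-tB/T),
   after which [JB] moves [J] to the right end. *)
by rewrite PhiT -(mulmxA _ M) MS KE -!mulmxA E JB.
Qed.
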